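(* Let $\mathcal{A}$ be an affine hyperplane arrangement in $\mathbb{R}^d$ whose characteristic polynomial is written in the form $\chi_{\mathcal{A}}(t)=\sum_{k=0}^d (-1)^{d-k}a_k t^k$. Let $k\in\{0,\ldots,d\}$. Then there is a set $E\subset\mathbb{R}^d$, which is a finite union of affine hyperplanes, such that $$\#\{P\in\mathcal{R}(\mathcal{A}):\ \dim(x,P)=k\}=a_k\qquad\text{for every }x\in\mathbb{R}^d\setminus E.$$
   Context: An affine hyperplane arrangement $\mathcal{A}=\{H_1,\ldots,H_m\}$ in $\mathbb{R}^d$ is a finite collection of pairwise distinct affine hyperplanes (not required to pass through the origin). The closures of the connected components of $\mathbb{R}^d\setminus\bigcup_{i=1}^m H_i$ are called (closed) chambers; $\mathcal{R}(\mathcal{A})$ is the set of all closed chambers. Each chamber is a polyhedral set, i.e. an intersection of finitely many closed half-spaces. The characteristic polynomial of $\mathcal{A}$ is $$\chi_{\mathcal{A}}(t)=\sum_{\mathcal{B}\subset\mathcal{A}:\ \bigcap_{H\in\mathcal{B}}H\neq\varnothing}(-1)^{\#\mathcal{B}}\,t^{\dim\left(\bigcap_{H\in\mathcal{B}}H\right)},$$ where for $\mathcal{B}=\varnothing$ the intersection is $\mathbb{R}^d$, contributing the term $t^d$. The numbers $a_0,\ldots,a_d$ are defined by $\chi_{\mathcal{A}}(t)=\sum_{k=0}^d(-1)^{d-k}a_kt^k$. For a polyhedral set $P$, its faces include $P$ itself (and only nonempty faces are considered). The relative interior of a face $F$ of $P$ consists of all points of $F$ not belonging to a face of strictly smaller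 dimension; $P$ is the disjoint union of the relative interiors of its faces. For $x\in\mathbb{R}^d$, the metric projection $\pi_P(x)$ is the unique point of $P$ minimizing the Euclidean distance to $x$. It lies in the relative interior of a unique face $F$ of $P$, and $\dim(x,P)$ denotes the dimension of this $F$. *)

(* Defs.v *)
From HB Require Import structures.
From mathcomp Require Import all_boot all_order all_algebra finmap.
From mathcomp Require Import all_classical all_reals all_analysis.

Set Implicit Arguments.
Unset Strict Implicit.
Unset Printing Implicit Defensive.

Import Order.TTheory GRing.Theory Num.Theory.
Import numFieldNormedType.Exports.

Local Open Scope classical_set_scope.
Local Open Scope ring_scope.

Section Definitions.
Context {R : realType} {d : nat}.
Implicit Types (x y c : 'rV[R]_d) (S P F L E : set 'rV[R]_d).

Definition dotp x y : R := \sum_(i < d) x 0 i * y 0 i.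

(* The library norm on matrices is the sup norm, hence this definition. *)
Definition enorm x : R := Num.sqrt (dotp x x).

Definition hyperplane c (b : R) : set 'rV[R]_d := [set x | dotp c x = b].

Definition is_hyperplane L := exists c b, c != 0 /\ L = hyperplane c b.

Definition finite_union_of_hyperplanes E :=
  exists n (G : 'I_n -> set 'rV[R]_d),
    (forall i, is_hyperplane (G i)) /\ E = \bigcup_i G i.

Definition flat x (V : {vspace 'rV[R]_d}) : set 'rV[R]_d :=
  [set y | y - x \in V].

Definition affine_hull S : set 'rV[R]_d :=
  \bigcap_(L in [set L | (exists x V, L = flat x V) /\ S `<=` L]) L.

(* Dimension of a nonempty set; it is only used for affine subspaces and for
   nonempty faces of polyhedral sets.  The value on the empty set is junk. *)
Definition adim S : nat :=
  xget 0%N [set n | exists x V, affine_hull S = flat x V /\ \dim V = n].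

(* Faces are cut out by valid linear inequalities.  The case c = 0, b = 0
   makes P a face of itself. *)
Definition is_face P F :=
  F !=set0 /\
  exists c (b : R), (forall y, P y -> dotp c y <= b) /\ F = P `&` hyperplane c b.

Definition relint P F : set 'rV[R]_d :=
  [set y | F y /\ forall F', is_face P F' -> (adim F' < adim F)%N -> ~ F' y].

Definition metric_proj P x : 'rV[R]_d :=
  xget x [set y | P y /\ forall z, P z -> enorm (x - y) <= enorm (x - z)].

(* dim(x, P); the face chosen here is unique when P is a nonempty polyhedral
   set. *)
Definition dim_proj x P : nat :=
  adim (xget set0 [set F | is_face P F /\ relint P F (metric_proj P x)]).

Section Arrangement.
Context {m : nat}.
Implicit Types (H : 'I_m -> set 'rV[R]_d) (B : {set 'I_m}).

Definition is_arrangement H := (forall i, is_hyperplane (H i)) /\ injective H.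

Definition chambers H : set (set 'rV[R]_d) :=
  [set closure (connected_component (~` \bigcup_i H i) x)
     | x in ~` \bigcup_i H i].

Definition arr_inter H B : set 'rV[R]_d := \bigcap_(i in [set` B]) H i.

Definition arr_char_poly H : {poly int} :=
  \sum_(B : {set 'I_m} | `[< arr_inter H B !=set0 >])
     (-1) ^+ #|B| *: 'X^(adim (arr_inter H B)).

End Arrangement.
End Definitions.

(* Main.v *)
Require Import Defs.
From mathcomp Require Import all_boot all_order all_algebra finmap.
From mathcomp Require Import all_classical all_reals all_analysis.
From mathcomp Require Import ring lra.
Import Order.TTheory GRing.Theory Num.Theory.
Import numFieldNormedType.Exports.
Local Open Scope classical_set_scope.
Local Open Scope ring_scope.

(** The characteristic polynomial satisfies deletion and restriction: for a
    hyperplane [H] of the arrangement [A], it is the polynomial of [A] without [H]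
    minus the polynomial of the arrangement induced on [H].  Since the induced
    arrangement has dimension one less, the signs in the definition of [a_k] turn
    the difference into a sum.  The numbers of chambers [P] with [dim(x, P) = k]
    satisfy the same recursion, for each generic point [x] separately.

    Let [P] be a chamber of [A] without [H] and let [p] be the projection of [x]
    on [P].  If [H] misses the interior of [P], nothing changes.  Otherwise [P] is
    cut into two halves by the slice [Q], the intersection of [P] and [H].
    - If [p] is not on [H], it is also the projection of [x] on the half that
      contains it, with the same face dimension.  The projection on the other half
      is on [H], since the segment from a point beyond [H] to [p] approaches [x];
      so it is the projection on [Q], and the face dimensions in that half and in
      [Q] agree.
    - If [p] is on [H], it is the projection of [x] on [P], on [Q] and on both
      halves.  For generic [x], the face of [P] through [p] is contained in [H],
      and the four dimensions agree.
    In both cases the two halves together count as much as [P] and [Q] together;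
    this is [hit_split].  The exceptional points are those whose projection on a
    flat of the arrangement lies on a hyperplane that cuts the flat properly: for
    each flat and each hyperplane they lie on one hyperplane
    ([generic_outside_hyperplanes]).

    To avoid changing the ambient space, the induction bears on pairs [(B, S)],
    where the hyperplanes of [S] cut the flat of [B] into cells
    ([whitney_coef_count]).  Restriction may make hyperplanes coincide, miss the
    flat or contain it, so the induction admits such hyperplanes.  The dimension
    of the face of a point [p] of a cell is the dimension of the intersection of
    the hyperplanes of the constraints active at [p] ([dim_proj_ccell]), and the
    chambers are the closed cells whose open cells are nonempty ([chambersE]). *)

Set Implicit Arguments.
Unset Strict Implicit.
Unset Printing Implicit Defensive.

(** * Euclidean geometry and the metric projection *)

Section EuclideanSpace.
Context {R : realType} {d : nat}.
Implicit Types (x y z v w p : 'rV[R]_d) (P S F : set 'rV[R]_d) (t : R).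

Lemma dotpC x y : dotp x y = dotp y x.
Proof. by apply: eq_bigr => i _; rewrite mulrC. Qed.

Lemma dotpDr x y z : dotp x (y + z) = dotp x y + dotp x z.
Proof. by rewrite -big_split; apply: eq_bigr => i _; rewrite mxE mulrDr. Qed.

Lemma dotpZr t x y : dotp x (t *: y) = t * dotp x y.
Proof. by rewrite big_distrr; apply: eq_bigr => i _; rewrite mxE mulrCA. Qed.

Lemma dotpNr x y : dotp x (- y) = - dotp x y.
Proof. by rewrite -scaleN1r dotpZr mulN1r. Qed.

Lemma dotpBr x y z : dotp x (y - z) = dotp x y - dotp x z.
Proof. by rewrite dotpDr dotpNr. Qed.

Lemma dotpDl x y z : dotp (x + y) z = dotp x z + dotp y z.
Proof. by rewrite !(dotpC _ z) dotpDr. Qed.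

Lemma dotpZl t x y : dotp (t *: x) y = t * dotp x y.
Proof. by rewrite !(dotpC _ y) dotpZr. Qed.

Lemma dotpNl x y : dotp (- x) y = - dotp x y.
Proof. by rewrite !(dotpC _ y) dotpNr. Qed.

Lemma dotp0l x : dotp 0 x = 0.
Proof. by rewrite -(scale0r 0) dotpZl mul0r. Qed.

Lemma dotp_suml (I : Type) (r : seq I) (A : pred I) (f : I -> 'rV[R]_d) y :
  dotp (\sum_(i <- r | A i) f i) y = \sum_(i <- r | A i) dotp (f i) y.
Proof.
apply: (big_ind2 (fun u e => dotp u y = e)) => // [|u e u' e' <- <-].
  exact: dotp0l.
exact: dotpDl.
Qed.

Lemma dotp_ge0 x : 0 <= dotp x x.
Proof. by apply: sumr_ge0 => i _; rewrite -expr2 sqr_ge0. Qed.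

Lemma dotp_eq0 x : dotp x x = 0 -> x = 0.
Proof.
move=> /eqP; rewrite /dotp psumr_eq0 => [|i _]; last by rewrite -expr2 sqr_ge0.
move=> /allP x0; apply/rowP => i; rewrite mxE; apply/eqP.
by have := x0 i (mem_index_enum i); rewrite mulf_eq0 orbb.
Qed.

Lemma sum_continuous (I : Type) (r : seq I) (f : I -> 'rV[R]_d -> R) :
  (forall i, continuous (f i)) -> continuous (fun x => \sum_(i <- r) f i x).
Proof.
move=> cf; elim: r => [|i r IHr] x.
  have -> : (fun y => \sum_(j <- [::]) f j y) = fun=> 0.
    by apply/funext => y; rewrite big_nil.
  exact: cst_continuous.
have -> : (fun y => \sum_(j <- i :: r) f j y) =
    fun y => f i y + \sum_(j <- r) f j y.
  by apply/funext => y; rewrite big_cons.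
by apply: (@continuousD _ _ _ (f i)); [exact: cf|exact: IHr].
Qed.

Lemma dotp_continuous x : continuous (dotp x).
Proof.
apply: sum_continuous => i y.
by apply: continuousM; [exact: cst_continuous|exact: coord_continuous].
Qed.

Definition sqdist x y : R := dotp (x - y) (x - y).

Lemma le_enorm x y z : (enorm (x - y) <= enorm (x - z)) = (sqdist x y <= sqdist x z).
Proof. by rewrite /enorm ler_sqrt // dotp_ge0. Qed.

Lemma sqdist_continuous x : continuous (sqdist x).
Proof.
apply: sum_continuous => i y.
have cvi : (fun z => (x - z) 0 i) @ y --> (x - y) 0 i.
  have -> : (fun z => (x - z) 0 i) = (fun z => x 0 i - z 0 i).
    by apply/funext => z; rewrite !mxE.
  rewrite !mxE; apply: continuousB; first exact: cst_continuous.
  exact: coord_continuous.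
exact: (continuousM cvi cvi).
Qed.

Lemma norm_le_enorm x : `|x| <= enorm x.
Proof.
rewrite [leLHS]/Num.norm /= mx_normrE; apply/bigmax_leP; split=> [|[i j] _] /=.
  exact: sqrtr_ge0.
rewrite -sqrtr_sqr ler_sqrt ?dotp_ge0 // ord1 expr2 /dotp (bigD1 j) //=.
by rewrite lerDl; apply: sumr_ge0 => k _; rewrite -expr2 sqr_ge0.
Qed.

Definition mix t y z : 'rV[R]_d := (1 - t) *: y + t *: z.

Lemma dotp_mix t x y z :
  dotp x (mix t y z) = (1 - t) * dotp x y + t * dotp x z.
Proof. by rewrite dotpDr !dotpZr. Qed.

Definition segment_closed S :=
  forall t y z, 0 <= t <= 1 -> S y -> S z -> S (mix t y z).

(** Strict convexity of the squared distance, with its exact defect. *)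
Lemma sqdist_mix t x y z : sqdist x (mix t y z) =
  (1 - t) * sqdist x y + t * sqdist x z - t * (1 - t) * sqdist y z.
Proof.
rewrite /sqdist /mix !(dotpDl, dotpDr, dotpNl, dotpNr, dotpZl, dotpZr).
rewrite (dotpC y x) (dotpC z x) (dotpC z y); ring.
Qed.

Lemma sqdist_move t x y v : sqdist x (y + t *: v) =
  sqdist x y - 2 * t * dotp (x - y) v + t ^+ 2 * dotp v v.
Proof.
rewrite /sqdist !(dotpDl, dotpDr, dotpNl, dotpNr, dotpZl, dotpZr).
rewrite (dotpC y x) (dotpC v x) (dotpC v y); ring.
Qed.

(** Only the part of [P] at distance at most that of some point of [P] matters,
    and this part is compact. *)
Lemma metric_projP P x : closed P -> P !=set0 ->
  P (metric_proj P x) /\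
  forall z, P z -> sqdist x (metric_proj P x) <= sqdist x z.
Proof.
move=> clP [q Pq].
suff [p [Pp pmin]] : exists p, P p /\ forall z, P z -> sqdist x p <= sqdist x z.
  have := @xgetPex _ x [set y | P y /\ forall z, P z ->
    enorm (x - y) <= enorm (x - z)].
  rewrite -/(metric_proj P x) => /(_ _)[|Pm mmin].
    by exists p; split=> // z Pz; rewrite le_enorm; exact: pmin.
  by split=> // z Pz; rewrite -le_enorm; exact: mmin.
pose K := P `&` [set y | sqdist x y <= sqdist x q].
have Kq : K q by split => /=.
have K0 : K !=set0 by exists q.
have compK : compact K.
  apply: bounded_closed_compact.
    exists (`|x| + enorm (x - q)); split; first exact: num_real.
    move=> M ltM y [_] /= yq; apply: le_trans (ltW ltM).
    have -> : y = x - (x - y) by rewrite opprB addrC subrK.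
    apply: le_trans (ler_normB _ _) _; rewrite lerD2l.
    by apply: le_trans (norm_le_enorm _) _; rewrite le_enorm.
  apply: closedI => //.
  have /continuous_closedP := @sqdist_continuous x.
  by move=> /(_ _ (@closed_le R (sqdist x q))).
have [p] := EVT_min_rV K0 compK (continuous_subspaceT (@sqdist_continuous x)).
rewrite inE => -[Pp pq] pmin; exists p; split=> // z Pz.
case: (leP (sqdist x z) (sqdist x q)) => [zq|/ltW zq].
  by apply: pmin; rewrite inE.
by apply: le_trans zq.
Qed.

Lemma sqdist_gt0 y z : y <> z -> 0 < sqdist y z.
Proof.
move=> yz; rewrite lt_neqAle dotp_ge0 andbT eq_sym; apply/eqP => /dotp_eq0/eqP.
by rewrite subr_eq0 => /eqP.
Qed.

(** The midpoint of two distinct minimizers would be strictly closer to [x]. *)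
Lemma metric_proj_eq P x p : segment_closed P -> P p ->
  (forall z, P z -> sqdist x p <= sqdist x z) -> metric_proj P x = p.
Proof.
move=> cP Pp pmin; rewrite /metric_proj; case: xgetP => [q _ [Pq qmin]|]; last first.
  by move=> /(_ p) []; split=> // z Pz; rewrite le_enorm; exact: pmin.
apply: contrapT => /sqdist_gt0 qp.
have half : 0 <= (2^-1 : R) <= 1 by lra.
have := pmin _ (cP _ _ _ half Pq Pp); rewrite sqdist_mix.
have := qmin _ Pp; rewrite le_enorm.
lra.
Qed.

End EuclideanSpace.

(** * Affine hulls and face dimensions *)

Section AffineHull.
Context {R : realType} {d : nat}.
Implicit Types (x y z v w p : 'rV[R]_d) (P S F : set 'rV[R]_d) (t : R).
Implicit Types (U V W : {vspace 'rV[R]_d}).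

(** A flat through [p] of least dimension among those containing [S] is contained
    in every flat containing [S]: intersecting the two cannot lower the
    dimension. *)
Lemma affine_hull_flat S p : S p -> exists V, affine_hull S = flat p V.
Proof.
move=> Sp.
pose spans n := `[< exists V, S `<=` flat p V /\ \dim V = n >].
have ex_span : exists n, spans n.
  exists (\dim (fullv : {vspace 'rV[R]_d})); apply/asboolP; exists fullv.
  by split=> // y _; rewrite /flat /= memvf.
case: (ex_minnP ex_span) => n /asboolP[V [SV dimV]] min_n; exists V.
apply/seteqP; split=> [y|y yV L [[x [U ->]] SU]].
  by apply; split=> //; exists p, V.
have SVU : S `<=` flat p (V :&: U)%VS.
  move=> s Ss; rewrite /flat /= memv_cap [X in X && _]SV //=.
  have -> : s - p = (s - x) - (p - x) by rewrite opprB addrA subrK.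
  by rewrite memvB //; exact: SU.
have dimVU : (\dim V <= \dim (V :&: U))%N.
  by rewrite dimV; apply: min_n; apply/asboolP; exists (V :&: U)%VS.
have /capv_idPl/subvP sVU : (V :&: U)%VS = V.
  by apply/eqP; rewrite eqEdim capvSl.
rewrite /flat /= -(subrK p y) -addrA memvD //; last exact: SU.
exact: sVU.
Qed.

Lemma flat_inj p V W : flat p V = flat p W -> V = W.
Proof.
move=> VW; apply/vspaceP => v.
have : flat p V (v + p) = flat p W (v + p) by rewrite VW.
by rewrite /flat /= addrK => /propeqP[vW Wv]; apply/idP/idP.
Qed.

Lemma flat_rebase x p V : flat x V p -> flat x V = flat p V.
Proof.
rewrite /flat /= => px; apply/seteqP; split=> y /= yV.
  have -> : y - p = (y - x) - (p - x) by rewrite opprB addrA subrK.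
  by rewrite memvB.
by rewrite -(subrK p y) -addrA memvD.
Qed.

Lemma adim_hull S p V : affine_hull S = flat p V -> adim S = \dim V.
Proof.
move=> hullS; rewrite /adim; case: xgetP => [n _ [x [U [hullU <-]]]|]; last first.
  by move=> /(_ (\dim V)) []; exists p, V.
have px : flat x U p by rewrite -hullU hullS /flat /= subrr mem0v.
by congr (\dim _); apply: (@flat_inj p); rewrite -(flat_rebase px) -hullU.
Qed.

(** The affine hull contains [p] and [p + t *: v], hence has the direction [v]. *)
Lemma leq_adim S p W : S p ->
  (forall v, v \in W -> exists2 t, t != 0 & S (p + t *: v)) ->
  (\dim W <= adim S)%N.
Proof.
move=> Sp SW; have [V hullS] := affine_hull_flat Sp.
rewrite (adim_hull hullS); apply: dimvS; apply/subvP => v /SW[t t0 Sv].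
have : affine_hull S (p + t *: v) by move=> L [_]; apply.
by rewrite hullS /flat /= addrAC subrr add0r rpredZeq (negPf t0).
Qed.

Lemma adim_eq S p W : S p -> S `<=` flat p W ->
  (forall v, v \in W -> exists2 t, t != 0 & S (p + t *: v)) ->
  adim S = \dim W.
Proof.
move=> Sp sSW SW; apply/eqP; rewrite eqn_leq (leq_adim Sp SW) andbT.
have [V hullS] := affine_hull_flat Sp; rewrite (adim_hull hullS).
apply: dimvS; apply/subvP => v vV.
have hv : affine_hull S (v + p) by rewrite hullS /flat /= addrK.
have : flat p W (v + p) by apply: hv; split=> //; exists p, W.
by rewrite /flat /= addrK.
Qed.

(** A face whose relative interior contains the projection has the least
    dimension among the faces that contain the projection.  The face chosen by
    [dim_proj] therefore does not matter, and its dimension can be computed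
    without comparing faces with each other. *)
Lemma dim_projE P x n : P (metric_proj P x) ->
  (forall F, is_face P F -> F (metric_proj P x) -> (n <= adim F)%N) ->
  (exists F, [/\ is_face P F, F (metric_proj P x) & adim F = n]) ->
  dim_proj x P = n.
Proof.
move=> Pp n_min [F [faceF Fp dimF]]; rewrite /dim_proj.
case: xgetP => [G _ [faceG [Gp minG]]|/(_ F) []].
  apply/eqP; rewrite eqn_leq n_min // andbT leqNgt -dimF; apply/negP => ltFG.
  exact: minG F faceF ltFG Fp.
split=> //; split=> // G faceG ltGF Gp.
by have := n_min G faceG Gp; rewrite -dimF leqNgt ltGF.
Qed.

End AffineHull.

(** * Linear algebra *)

Section Normals.
Context {R : realType} {d : nat}.
Implicit Types (c v : 'rV[R]_d) (U W : {vspace 'rV[R]_d}).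

Definition perpv c : {vspace 'rV[R]_d} := lker (linfun (mulmxr c^T)).

Lemma mem_perpv c v : (v \in perpv c) = (dotp c v == 0).
Proof.
rewrite memv_ker lfunE /=.
have <- : (v *m c^T) 0 0 = dotp c v.
  by rewrite mxE; apply: eq_bigr => i _; rewrite mxE mulrC.
apply/eqP/eqP => [->|v0]; first by rewrite mxE.
by apply/matrixP => i j; rewrite !ord1 v0 mxE.
Qed.

(** A linear form that does not vanish on [W] has rank one there. *)
Lemma dim_cap_perpv W c : ~~ (W <= perpv c)%VS ->
  (\dim (W :&: perpv c)).+1 = \dim W.
Proof.
move=> Wc; rewrite -(limg_ker_dim (linfun (mulmxr c^T)) W) -addn1.
congr (_ + _)%N; apply/eqP; rewrite eq_sym eqn_leq; apply/andP; split.
  by apply: leq_trans (dimvS (subvf _)) _; rewrite dimvf /dim /= mul1n.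
by rewrite lt0n dimv_eq0 -lkerE.
Qed.

(** The pairing with a basis of [U] has fewer coordinates than the dimension of
    [W], so that it is not injective on [W]. *)
Lemma ex_orthogonal U W : (U <= W)%VS -> ~~ (W <= U)%VS ->
  exists w, [/\ w != 0, w \in W & forall u, u \in U -> dotp w u = 0].
Proof.
move=> UW WU.
pose M := (\matrix_(i < \dim U) (vbasis U)`_i)^T.
pose f := linfun (mulmxr M : 'rV[R]_d -> 'rV[R]_(\dim U)).
have : (W :&: lker f != 0)%VS.
  rewrite -dimv_eq0 -lt0n.
  have := limg_ker_dim f W.
  have : (\dim (f @: W) <= \dim U)%N.
    by apply: leq_trans (dimvS (subvf _)) _; rewrite dimvf /dim /= mul1n.
  have : (\dim U < \dim W)%N.
    rewrite ltnNge; apply: contra WU => dimWU.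
    by have /eqP <- : U == W by rewrite eqEdim UW.
  by case: (\dim (W :&: lker f)) => // + + e; rewrite -e add0n ltnNge => /negP.
move=> Wf; exists (vpick (W :&: lker f)).
have := memv_pick (W :&: lker f); rewrite memv_cap memv_ker lfunE /=.
set w := vpick _ => /andP[wW /eqP wM]; split=> [||u uU]; rewrite ?vpick0 //.
rewrite dotpC (coord_vbasis uU) dotp_suml big1 // => i _.
rewrite dotpZl dotpC; have := congr1 (fun r : 'rV_(\dim U) => r 0 i) wM.
rewrite !mxE => wi; rewrite (_ : dotp _ _ = 0) ?mulr0 // -wi.
by apply: eq_bigr => j _; rewrite !mxE.
Qed.

(** Finitely many strict inequalities survive a small move.  The bound is the
    inverse of [1] plus the sum of all the relative speeds [`|w i| / u i]. *)
Lemma small_step (I : finType) (A : {set I}) (u w : I -> R) :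
  (forall i, i \in A -> 0 < u i) ->
  exists2 e, 0 < e &
    forall t i, `|t| <= e -> i \in A -> 0 < u i + t * w i.
Proof.
move=> u0; pose s := \sum_(i in A) `|w i| / u i.
have s0 : 0 <= s by apply: sumr_ge0 => i /u0 ui; rewrite divr_ge0 // ltW.
have s1 : 0 < 1 + s by rewrite ltr_pwDl.
exists (1 + s)^-1 => [|t i te iA]; first by rewrite invr_gt0.
have ui := u0 i iA.
have wi : `|w i| / u i <= s.
  rewrite /s (bigD1 i) //= lerDl; apply: sumr_ge0 => j /andP[/u0 uj _].
  by rewrite divr_ge0 // ltW.
have : `|t * w i| < u i.
  rewrite normrM; apply: le_lt_trans (ler_wpM2r (normr_ge0 _) te) _.
  rewrite mulrC ltr_pdivrMr // mulrDr mulr1.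
  by rewrite ltr_pwDl // mulrC -ler_pdivrMr.
by rewrite ltr_norml => /andP[+ _]; rewrite -subr_gt0 opprK addrC.
Qed.

End Normals.

(** * Cells and their faces *)

Section Cells.
Context {R : realType} {d m : nat}.
Variables (c : 'I_m -> 'rV[R]_d) (b : 'I_m -> R).
Implicit Types (x y z v w p : 'rV[R]_d) (t : R) (B S T : {set 'I_m}).

Definition gap i y : R := dotp (c i) y - b i.

Lemma gap_mix i t y z : gap i (mix t y z) = (1 - t) * gap i y + t * gap i z.
Proof. by rewrite /gap dotp_mix; ring. Qed.

Lemma gap_move i t y v : gap i (y + t *: v) = gap i y + t * dotp (c i) v.
Proof. by rewrite /gap dotpDr dotpZr; ring. Qed.

Lemma gap_continuous i : continuous (gap i).
Proof.
move=> y; apply: continuousB; last exact: cst_continuous.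
exact: dotp_continuous.
Qed.

Definition side T i : R := if i \in T then 1 else -1.

Lemma side_neq0 T i : side T i != 0.
Proof. by rewrite /side; case: ifP; rewrite ?oppr_eq0 oner_neq0. Qed.

Definition flat_of B := [set y | forall i, i \in B -> gap i y = 0].

(** A cell is encoded by a set [B] of hyperplanes it lies on, a set [S] of
    hyperplanes that bound it, and the set [T] of those hyperplanes of [S] that
    have it on their positive side.  Equations and walls are kept apart because
    restriction to a hyperplane moves an index from [S] to [B]. *)
Definition ccell B S T :=
  [set y | flat_of B y /\ forall i, i \in S -> 0 <= side T i * gap i y].

Definition ocell B S T :=
  [set y | flat_of B y /\ forall i, i \in S -> 0 < side T i * gap i y].

Definition dir B : {vspace 'rV[R]_d} := (\bigcap_(i in B) perpv (c i))%VS.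

Lemma mem_dir B v : reflect (forall i, i \in B -> dotp (c i) v = 0) (v \in dir B).
Proof.
apply: (iffP (@subv_bigcapP _ _ _ _ <[v]>%VS _)) => vB i iB.
  by apply/eqP; rewrite -mem_perpv; apply: vB.
by have := vB i iB => /eqP; rewrite -mem_perpv.
Qed.

Lemma dirU1 B i : dir (i |: B) = (dir B :&: perpv (c i))%VS.
Proof.
apply/vspaceP => v; rewrite memv_cap mem_perpv.
apply/mem_dir/andP => [vB|[/mem_dir vB /eqP vi] j].
  split; first by apply/mem_dir => j jB; rewrite vB // in_setU1 jB orbT.
  by rewrite vB // in_setU1 eqxx.
by rewrite in_setU1 => /predU1P[->|/vB].
Qed.

Lemma ocell_sub B S T : ocell B S T `<=` ccell B S T.
Proof. by move=> y [yB yS]; split=> // i /yS/ltW. Qed.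

Lemma ccell_segment B S T : segment_closed (ccell B S T).
Proof.
move=> t y z /andP[t0 t1] [yB yS] [zB zS]; split=> i iA.
  by rewrite gap_mix yB // zB // !mulr0 addr0.
rewrite gap_mix mulrDr mulrCA (mulrCA _ t) addr_ge0 // mulr_ge0 ?subr_ge0 //.
  exact: yS.
exact: zS.
Qed.

(** A positive weight on the point [z] of the open cell makes every inequality
    strict. *)
Lemma ocell_mix B S T t y z : 0 < t <= 1 ->
  ccell B S T y -> ocell B S T z -> ocell B S T (mix t y z).
Proof.
move=> /andP[t0 t1] [yB yS] [zB zS]; split=> i iA.
  by rewrite gap_mix yB // zB // !mulr0 addr0.
rewrite gap_mix mulrDr mulrCA (mulrCA _ t) ltr_wpDl //.
  by rewrite mulr_ge0 ?subr_ge0 // yS.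
by rewrite mulr_gt0 // zS.
Qed.

Lemma ccell_closed B S T : closed (ccell B S T).
Proof.
have -> : ccell B S T =
    (\bigcap_(i in [set` B]) gap i @^-1` [set r | r = 0]) `&`
    \bigcap_(i in [set` S]) (fun y => side T i * gap i y) @^-1` [set r | 0 <= r].
  apply/seteqP; split=> y [yB yS]; split=> i /= iA; do ?[exact: yB|exact: yS].
apply: closedI; apply: closed_bigI => i _.
  by have /continuous_closedP := @gap_continuous i; apply; exact: closed_eq.
have /continuous_closedP : continuous (fun y => side T i * gap i y).
  move=> y; apply: continuousM; first exact: cst_continuous.
  exact: gap_continuous.
by apply; exact: closed_ge.
Qed.

Definition active S p := [set i in S | gap i p == 0].

(** The directions that keep the active constraints active can be followed both
    ways for a while, since the other constraints are strict at [p]. *)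
Lemma ccell_move B S T p v : ccell B S T p -> v \in dir (B :|: active S p) ->
  exists2 e, 0 < e & forall t, `|t| <= e -> ccell B S T (p + t *: v).
Proof.
move=> [pB pS] /mem_dir vBA.
have [|e e0 he] := @small_step R _ (S :\: active S p)
    (fun i => side T i * gap i p) (fun i => side T i * dotp (c i) v).
  move=> i; rewrite !inE negb_and; case: (boolP (i \in S)) => //= iS.
  rewrite andbT => gi; rewrite lt_neqAle pS // andbT eq_sym.
  by rewrite mulf_eq0 (negPf (side_neq0 _ _)).
exists e => // t te; split=> i iA; rewrite gap_move.
  by rewrite pB // vBA ?inE ?iA // mulr0 addr0.
have [ip|ip] := boolP (i \in active S p).
  by rewrite vBA ?inE ?iA ?orbT // ?mulr0 ?addr0 ?pS //;
     move: ip; rewrite !inE iA /= => ->; rewrite orbT.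
by rewrite mulrDr (mulrCA _ t); apply/ltW/he; rewrite // !inE iA andbT;
   move: ip; rewrite !inE iA.
Qed.

Lemma ocell_move B S T z v : ocell B S T z -> v \in dir B ->
  exists2 e, 0 < e & forall t, `|t| <= e -> ocell B S T (z + t *: v).
Proof.
move=> [zB zS] /mem_dir vB.
have [e e0 he] := @small_step R _ S _ (fun i => side T i * dotp (c i) v) zS.
exists e => // t te; split=> i iA; rewrite gap_move.
  by rewrite zB // vB // mulr0 addr0.
by rewrite mulrDr (mulrCA _ t); exact: he.
Qed.

(** A linear form that is maximal at [p] over the cell is constant along any
    segment of the cell having [p] in its interior. *)
Lemma adim_face_ge B S T p F : is_face (ccell B S T) F -> F p ->
  (\dim (dir (B :|: active S p)) <= adim F)%N.
Proof.
move=> [_ [a [r [valid ->]]]] [Cp pr]; apply: (leq_adim (p := p)) => // v vW.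
have [e e0 Ce] := ccell_move Cp vW; exists e; first by rewrite gt_eqF.
have Cpe : ccell B S T (p + e *: v) by apply: Ce; rewrite ger0_norm // ltW.
have Cme : ccell B S T (p + (- e) *: v) by apply: Ce; rewrite normrN ger0_norm // ltW.
split=> //; move: (valid _ Cpe) (valid _ Cme).
by rewrite /hyperplane /= in pr *; rewrite !dotpDr !dotpZr pr => h1 h2; lra.
Qed.

(** The active constraints, added up, cut out the face of points at which all of
    them are active. *)
Lemma active_face B S T p : ccell B S T p ->
  exists F, [/\ is_face (ccell B S T) F, F p &
    adim F = \dim (dir (B :|: active S p))].
Proof.
move=> Cp; pose A := active S p.
pose a := - \sum_(i in A) side T i *: c i.
pose r := - \sum_(i in A) side T i * b i.
have arE y : r - dotp a y = \sum_(i in A) side T i * gap i y.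
  rewrite /a /r dotpNl dotp_suml opprK addrC -sumrB.
  by apply: eq_bigr => i _; rewrite dotpZl /gap mulrBr.
have AS i : i \in A -> i \in S by rewrite inE => /andP[].
have gapA i : i \in A -> gap i p = 0 by rewrite inE => /andP[_ /eqP].
have term_ge0 y : ccell B S T y -> forall i, i \in A -> 0 <= side T i * gap i y.
  by move=> [_ yS] i /AS/yS.
pose F := ccell B S T `&` hyperplane a r.
have FE y : F y <-> ccell B S T y /\ forall i, i \in A -> gap i y = 0.
  split=> -[Cy yA]; split=> //.
    move=> i iA; have : \sum_(i in A) side T i * gap i y = 0.
      by rewrite -arE yA subrr.
    move/eqP; rewrite psumr_eq0; last exact: term_ge0.
    move=> /allP/(_ i (mem_index_enum i)); rewrite iA /= mulf_eq0.
    by rewrite (negPf (side_neq0 _ _)) => /eqP.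
  apply/eqP; rewrite -subr_eq0 -oppr_eq0 opprB arE; apply/eqP.
  by apply: big1 => i iA; rewrite yA // mulr0.
have Fp : F p by apply/FE.
exists F; split=> //.
  split; first by exists p.
  exists a, r; split=> // y Cy; rewrite -subr_ge0 arE.
  by apply: sumr_ge0 => i; exact: term_ge0.
apply: (adim_eq Fp) => [y /FE[[yB _] yA]|v vW].
  apply/mem_dir => i; rewrite inE dotpBr => iBA.
  have -> : dotp (c i) y - dotp (c i) p = gap i y - gap i p by rewrite /gap; ring.
  case/orP: iBA => [iB|iA]; last by rewrite yA // gapA // subrr.
  by case: Cp => pB _; rewrite yB // pB // subrr.
have [e e0 Ce] := ccell_move Cp vW; exists e; first by rewrite gt_eqF.
apply/FE; split=> [|i iA]; first by apply: Ce; rewrite ger0_norm // ltW.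
by rewrite gap_move gapA // (mem_dir _ _ vW) ?mulr0 ?addr0 // inE iA orbT.
Qed.

Lemma ccell_projP B S T x : ccell B S T !=set0 ->
  ccell B S T (metric_proj (ccell B S T) x) /\
  forall z, ccell B S T z ->
    sqdist x (metric_proj (ccell B S T) x) <= sqdist x z.
Proof. exact/metric_projP/ccell_closed. Qed.

Lemma dim_proj_ccell B S T x : ccell B S T !=set0 ->
  dim_proj x (ccell B S T) =
  \dim (dir (B :|: active S (metric_proj (ccell B S T) x))).
Proof.
move=> /(ccell_projP x)[Cp _]; apply: dim_projE => // [F|].
  exact: adim_face_ge.
exact: active_face.
Qed.

(** Moving from [p] along [t *: v] changes the squared distance by
    [t ^+ 2 * dotp v v - 2 * t * dotp (x - p) v], which has both signs near [0]
    unless its linear term vanishes. *)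
Lemma proj_residual_orthogonal B S T x p v : ccell B S T p ->
  (forall z, ccell B S T z -> sqdist x p <= sqdist x z) ->
  v \in dir (B :|: active S p) -> dotp (x - p) v = 0.
Proof.
move=> Cp pmin vW; have [e e0 Ce] := ccell_move Cp vW.
set a := dotp (x - p) v; set q := dotp v v.
have q0 : 0 <= q by exact: dotp_ge0.
have quad t : `|t| <= e -> 0 <= t * (t * q - 2 * a).
  move=> /Ce/pmin; rewrite sqdist_move -/a -/q => h.
  by rewrite (_ : _ * _ = t ^+ 2 * q - 2 * t * a); [lra | ring].
apply/eqP/negPn/negP => a0.
have na : 0 < `|a| by rewrite normr_gt0.
(* Steps below [2 * `|a| / q] taken with the sign of [a] shorten the distance;
   the denominator [q + 1] avoids a case distinction on [q = 0]. *)
pose s := Num.min e (`|a| / (q + 1)).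
have s0 : 0 < s by rewrite lt_min e0 divr_gt0 // ltr_wpDl.
have se : s <= e by rewrite ge_min lexx.
have sq : s * q < `|a|.
  have : s * (q + 1) <= `|a|.
    by rewrite -ler_pdivlMr ?ltr_wpDl // ge_min lexx orbT.
  by rewrite mulrDr mulr1; lra.
have [ap|an|/eqP] := ltgtP a 0; last by rewrite (negPf a0).
  have := quad (- s); rewrite normrN ger0_norm ?(ltW s0) // => /(_ se).
  rewrite ltr0_norm // in sq; rewrite mulNr -mulrN pmulr_rge0 //; lra.
have := quad s; rewrite ger0_norm ?(ltW s0) // => /(_ se).
rewrite gtr0_norm // in sq; rewrite pmulr_rge0 //; lra.
Qed.

End Cells.

(** * Deletion and restriction for cells *)

Section Counting.
Context {R : realType} {d m : nat}.
Variables (c : 'I_m -> 'rV[R]_d) (b : 'I_m -> R).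
Implicit Types (x y z v w p : 'rV[R]_d) (t : R) (B S T U : {set 'I_m}).
Implicit Types (i j : 'I_m) (k : nat).

Local Notation gap := (gap c b).
Local Notation flat_of := (flat_of c b).
Local Notation ccell := (ccell c b).
Local Notation ocell := (ocell c b).
Local Notation dir := (dir c).
Local Notation active := (active c b).

(** The point [x] is exceptional when its orthogonal projection on some flat of the
    arrangement lies on a hyperplane that cuts this flat properly. *)
Definition generic x := forall B i p, flat_of B p -> gap i p = 0 ->
  (forall v, v \in dir B -> dotp (x - p) v = 0) -> (dir B <= perpv (c i))%VS.

Lemma flat_of_sub_dir B y z : flat_of B y -> flat_of B z -> y - z \in dir B.
Proof.
move=> yB zB; apply/mem_dir => i iB; rewrite dotpBr.
by have := yB i iB; have := zB i iB; rewrite /gap; lra.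
Qed.

(** For a flat of direction [dir B] cut properly by the hyperplane [i], choose
    [w] in [dir B] orthogonal to the intersection.  The form [dotp w] is constant
    on the intersection and takes the same value at a point and at its projection
    on the flat, so that all the exceptional points of this pair lie on one
    hyperplane of normal [w]. *)
Lemma generic_outside_hyperplanes : (forall i, c i != 0) ->
  exists E : set 'rV[R]_d, finite_union_of_hyperplanes E /\
    forall x, ~ E x -> generic x.
Proof.
move=> c0.
pose bad B i x := exists p, [/\ flat_of B p, gap i p = 0,
  forall v, v \in dir B -> dotp (x - p) v = 0 & ~~ (dir B <= perpv (c i))%VS].
have ex_cover (Bi : {set 'I_m} * 'I_m) : exists G : set 'rV[R]_d,
    is_hyperplane G /\ forall x, bad Bi.1 Bi.2 x -> G x.
  case: Bi => B i /=.
  have [[x0 [p0 [p0B p0i _ nBi]]]|nobad] := pselect (exists x, bad B i x); last first.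
    (* any hyperplane will do here *)
    exists (hyperplane (c i) (b i)); split; first by exists (c i), (b i).
    by move=> x badx; case: nobad; exists x.
  have [||w [w0 wB wU]] := @ex_orthogonal R d (dir B :&: perpv (c i))%VS (dir B).
  - exact: capvSl.
  - by rewrite subv_cap subvv.
  exists (hyperplane w (dotp w p0)); split; first by exists w, (dotp w p0).
  move=> x [p [pB pi xp _]]; rewrite /hyperplane /=.
  have -> : dotp w x = dotp w p.
    by apply/eqP; rewrite -subr_eq0 -dotpBr dotpC xp.
  apply/eqP; rewrite -subr_eq0 -dotpBr wU // memv_cap flat_of_sub_dir //=.
  rewrite mem_perpv dotpBr; apply/eqP.
  by move: pi p0i; rewrite /gap; lra.
have [G GP] := choice ex_cover.
pose F (j : 'I_#|{: {set 'I_m} * 'I_m}|) := G (enum_val j).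
exists (\bigcup_j F j); split.
  by eexists; exists F; split=> // j; case: (GP (enum_val j)).
move=> x nEx B i p pB pi xp; apply: contrapT => /negP nBi; apply: nEx.
exists (enum_rank (B, i)) => //; rewrite /F enum_rankK.
by apply: (GP (B, i)).2; exists p.
Qed.

Lemma side_agree S T U i : (forall j, j \in S -> (j \in T) = (j \in U)) ->
  i \in S -> side T i = side U i :> R.
Proof. by move=> TU iS; rewrite /side TU. Qed.

Lemma ccell_agree B S T U : (forall j, j \in S -> (j \in T) = (j \in U)) ->
  ccell B S T = ccell B S U.
Proof.
by move=> TU; apply/seteqP; split=> y [yB yS]; split=> // i iS;
  [rewrite -(side_agree TU iS)|rewrite (side_agree TU iS)]; exact: yS.
Qed.

Lemma ocell_agree B S T U : (forall j, j \in S -> (j \in T) = (j \in U)) ->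
  ocell B S T = ocell B S U.
Proof.
by move=> TU; apply/seteqP; split=> y [yB yS]; split=> // i iS;
  [rewrite -(side_agree TU iS)|rewrite (side_agree TU iS)]; exact: yS.
Qed.

Lemma flat_ofU1 B i y : flat_of (i |: B) y <-> flat_of B y /\ gap i y = 0.
Proof.
split=> [yB|[yB yi] j]; last by rewrite in_setU1 => /predU1P[->|/yB].
by split=> [j jB|]; apply: yB; rewrite in_setU1 ?jB ?orbT ?eqxx.
Qed.

Lemma ccell_wall B S T i y :
  ccell (i |: B) S T y <-> ccell B S T y /\ gap i y = 0.
Proof.
split=> [[/flat_ofU1[yB yi] yS]|[[yB yS] yi]]; first by do 2?split.
by split=> //; apply/flat_ofU1.
Qed.

Lemma ocell_wall B S T i y :
  ocell (i |: B) S T y <-> ocell B S T y /\ gap i y = 0.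
Proof.
split=> [[/flat_ofU1[yB yi] yS]|[[yB yS] yi]]; first by do 2?split.
by split=> //; apply/flat_ofU1.
Qed.

Lemma ccell_half B S T i y :
  ccell B (i |: S) T y <-> ccell B S T y /\ 0 <= side T i * gap i y.
Proof.
split=> [[yB yS]|[[yB yS] yi]].
  by split; [split=> // j jS|]; apply: yS; rewrite in_setU1 ?jS ?orbT ?eqxx.
by split=> // j; rewrite in_setU1 => /predU1P[->|/yS].
Qed.

Lemma ocell_half B S T i y :
  ocell B (i |: S) T y <-> ocell B S T y /\ 0 < side T i * gap i y.
Proof.
split=> [[yB yS]|[[yB yS] yi]].
  by split; [split=> // j jS|]; apply: yS; rewrite in_setU1 ?jS ?orbT ?eqxx.
by split=> // j; rewrite in_setU1 => /predU1P[->|/yS].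
Qed.

Lemma active_wall B S i p : gap i p = 0 ->
  B :|: active (i |: S) p = (i |: B) :|: active S p.
Proof.
move=> pi; apply/setP => j; rewrite !inE.
by case: eqVneq => [->|_] /=; rewrite ?pi ?eqxx ?orbT.
Qed.

Lemma dim_proj_witness x B S T p : ccell B S T p ->
  (forall z, ccell B S T z -> sqdist x p <= sqdist x z) ->
  dim_proj x (ccell B S T) = \dim (dir (B :|: active S p)).
Proof.
move=> Cp pmin; rewrite dim_proj_ccell; last by exists p.
by rewrite (metric_proj_eq _ Cp pmin) //; exact: ccell_segment.
Qed.

(** In the next four lemmas a new wall [i] is added to a cell of which [p] is the
    point nearest to [x]. *)
Section Wall.
Variables (x : 'rV[R]_d) (B S T : {set 'I_m}) (i : 'I_m) (p : 'rV[R]_d).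
Hypothesis Cp : ccell B S T p.
Hypothesis pmin : forall z, ccell B S T z -> sqdist x p <= sqdist x z.

Lemma dim_proj_near_side : 0 < side T i * gap i p ->
  dim_proj x (ccell B (i |: S) T) = dim_proj x (ccell B S T).
Proof.
move=> pi; rewrite (dim_proj_witness Cp pmin) (@dim_proj_witness _ _ _ _ p).
- congr (\dim (dir (_ :|: _))); apply/setP => j; rewrite !inE.
  case: eqVneq => //= ->; case: eqVneq pi => [->|]; last by rewrite andbF.
  by rewrite mulr0 ltxx.
- by apply/ccell_half; rewrite ltW.
- by move=> z /ccell_half[Cz _]; exact: pmin.
Qed.

(** If the nearest point of the cell lies strictly beyond the wall, the nearest
    point of the half on this side lies on the wall: otherwise the segment
    joining the two points would cross the wall closer to [x]. *)
Lemma dim_proj_far_side : side T i * gap i p < 0 ->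
  ccell (i |: B) S T !=set0 ->
  dim_proj x (ccell B (i |: S) T) = dim_proj x (ccell (i |: B) S T).
Proof.
move=> pi [y /ccell_wall[Cy yi]].
have [|Cq qmin] := @ccell_projP _ _ _ c b B (i |: S) T x.
  by exists y; apply/ccell_half; rewrite yi mulr0.
set q := metric_proj _ x in Cq qmin.
have [Cq0 qi0] := iffLR (ccell_half _ _ _ _ _) Cq.
have qi : gap i q = 0.
  apply/eqP/negPn/negP => qn0.
  have qi : 0 < side T i * gap i q.
    by rewrite lt_neqAle qi0 eq_sym mulf_neq0 ?side_neq0.
  set u := side T i * gap i q in qi; set w := side T i * gap i p in pi.
  have uw : 0 < u - w by lra.
  (* the time at which the segment from [q] to [p] crosses the wall *)
  pose t := u / (u - w).
  have t0 : 0 < t by rewrite divr_gt0.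
  have t1 : t < 1 by rewrite ltr_pdivrMr //; lra.
  have tuw : t * (u - w) = u by rewrite divfK // gt_eqF.
  have Cr : ccell B (i |: S) T (mix t q p).
    apply/ccell_half; split.
      by apply: ccell_segment => //; apply/andP; split; apply/ltW.
    rewrite gap_mix mulrDr mulrCA (mulrCA _ t) -/u -/w; lra.
  have := qmin _ Cr; have := pmin Cq0; rewrite sqdist_mix.
  have qp : 0 < sqdist q p.
    by apply: sqdist_gt0 => qp; move: pi qi; rewrite /u /w qp; lra.
  have : 0 < t * (1 - t) * sqdist q p 
    by apply: mulr_gt0 => //; apply: mulr_gt0; rewrite // subr_gt0.
  move=> h1 h2 h3.
  have : 0 <= t * (sqdist x q - sqdist x p).
    by apply: mulr_ge0; [exact: ltW | rewrite subr_ge0].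
  lra.
rewrite (dim_proj_witness Cq qmin) (@dim_proj_witness _ _ _ _ q).
- by rewrite active_wall.
- by apply/ccell_wall.
- by move=> z /ccell_wall[Cz zi]; apply: qmin; apply/ccell_half; rewrite zi mulr0.
Qed.

Lemma dim_proj_wall_half : gap i p = 0 ->
  dim_proj x (ccell B (i |: S) T) = dim_proj x (ccell (i |: B) S T).
Proof.
move=> pi; rewrite !(@dim_proj_witness _ _ _ _ p) ?active_wall //.
- by apply/ccell_wall.
- by move=> z /ccell_wall[Cz _]; exact: pmin.
- by apply/ccell_half; rewrite pi mulr0.
- by move=> z /ccell_half[Cz _]; exact: pmin.
Qed.

(** Genericity forces the whole face through a projection on the wall to lie in
    the wall. *)
Lemma dim_proj_wall : generic x -> gap i p = 0 ->
  dim_proj x (ccell (i |: B) S T) = dim_proj x (ccell B S T).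
Proof.
move=> genx pi; rewrite !(@dim_proj_witness _ _ _ _ p) //; first last.
- by move=> z /ccell_wall[Cz _]; exact: pmin.
- by apply/ccell_wall.
rewrite -finset.setUA dirU1; congr (\dim _); apply/capv_idPl.
apply: (genx _ _ p) => //; last by move=> v; exact: proj_residual_orthogonal pmin.
by case: Cp => pB _ j; rewrite !inE => /orP[/pB//|/andP[_ /eqP]].
Qed.

End Wall.

Definition hit x k B S T : bool :=
  `[< ocell B S T !=set0 >] && (dim_proj x (ccell B S T) == k).

Lemma hit_empty x k B S T : ~ (ocell B S T !=set0) -> hit x k B S T = false.
Proof. by move=> /asboolPn/negPf; rewrite /hit => ->. Qed.

Lemma hit_nonempty x k B S T : ocell B S T !=set0 ->
  hit x k B S T = (dim_proj x (ccell B S T) == k).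
Proof. by move=> /asboolP; rewrite /hit => ->. Qed.

Lemma ccell_agreeU1 B S T i : i \notin S -> ccell B S (i |: T) = ccell B S T.
Proof.
move=> iS; apply: ccell_agree => j jS; rewrite in_setU1.
by case: eqVneq jS iS => // -> ->.
Qed.

Lemma ocell_agreeU1 B S T i : i \notin S -> ocell B S (i |: T) = ocell B S T.
Proof.
move=> iS; apply: ocell_agree => j jS; rewrite in_setU1.
by case: eqVneq jS iS => // -> ->.
Qed.

Lemma sideU1 T i : side (i |: T) i = 1 :> R.
Proof. by rewrite /side in_setU1 eqxx. Qed.

Lemma side_notin T i : i \notin T -> side T i = -1 :> R.
Proof. by rewrite /side => /negPf ->. Qed.

(** An open cell that does not meet the wall lies on one side of it, by convexity,
    and its closed cell then lies on the same side: a point beyond the wall,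
    pushed slightly towards the open cell, would enter the open cell. *)
Lemma hit_uncut x k B S T U i z : side T i = - side U i :> R ->
  (forall j, j \in S -> (j \in T) = (j \in U)) ->
  ~ (ocell (i |: B) S U !=set0) -> ocell B (i |: S) U z ->
  hit x k B (i |: S) U = hit x k B S U /\ hit x k B (i |: S) T = false.
Proof.
move=> TU agTU nocut Oz.
have [Oz0 zi] := iffLR (ocell_half _ _ _ _ _) Oz.
have no0 y : ocell B S U y -> gap i y <> 0.
  by move=> Oy yi; apply: nocut; exists y; apply/ocell_wall.
have cross y : ocell B S U y -> 0 <= side U i * gap i y.
  move=> Oy; rewrite leNgt; apply/negP => yi.
  set u := side U i * gap i y in yi; set w := side U i * gap i z in zi.
  have wu : 0 < w - u by lra.
  (* the time at which the segment from [y] to [z] crosses the wall *)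
  pose t := (- u) / (w - u).
  have t0 : 0 < t by rewrite divr_gt0 // oppr_gt0.
  have t1 : t < 1 by rewrite ltr_pdivrMr //; lra.
  have tuw : t * (w - u) = - u by rewrite divfK // gt_eqF.
  apply: (@no0 (mix t y z)).
    by apply: ocell_mix => //; [rewrite t0 ltW | exact: ocell_sub].
  apply/eqP; have : side U i * gap i (mix t y z) = 0.
    by rewrite gap_mix mulrDr mulrCA (mulrCA _ t) -/u -/w; lra.
  by move/eqP; rewrite mulf_eq0 (negPf (side_neq0 _ _)).
split; last first.
  apply: hit_empty => -[y /ocell_half[]]; rewrite (ocell_agree _ agTU) TU => Oy.
  by have := cross y Oy; lra.
rewrite !hit_nonempty; [|by exists z|by exists z].
congr (dim_proj _ _ == _); apply/seteqP; split=> y; first by case/ccell_half.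
move=> Cy; apply/ccell_half; split=> //; rewrite leNgt; apply/negP => yi.
set u := side U i * gap i y in yi; set w := side U i * gap i z in zi.
have wu : 0 < w - u by lra.
(* half of the crossing time: the point is already in the open cell, and still
   on the wrong side *)
pose t := (- u) / (w - u) / 2.
have t0 : 0 < t by do 2!apply: divr_gt0 => //; rewrite oppr_gt0.
have tuw : t * (w - u) = - u / 2 by rewrite /t mulrAC divfK // gt_eqF.
have t1 : t <= 1.
  by rewrite -(ler_pM2r wu) tuw; lra.
have : ocell B S U (mix t y z) by apply: ocell_mix => //; rewrite t0.
by move=> /cross; rewrite gap_mix mulrDr mulrCA (mulrCA _ t) -/u -/w; lra.
Qed.

(** Deletion and restriction hold cell by cell.  When the wall cuts the cell,
    the half that contains the projection keeps the face of that projection,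
    and the projection on the other half is the projection on the slice of the
    cell by the wall.  When the wall misses the cell, one half is the whole cell
    and the other half and the slice are empty. *)
Lemma hit_split x k B S T i : generic x -> i \notin S -> T \subset S ->
  ~ (flat_of B `<=` [set y | gap i y = 0]) ->
  (hit x k B (i |: S) T + hit x k B (i |: S) (i |: T) =
   hit x k B S T + hit x k (i |: B) S T)%N.
Proof.
move=> genx iS TS /existsNP[y /not_implyP[yB yi]].
have iT : i \notin T by apply: contra iS; exact: (fintype.subsetP TS).
have agT j : j \in S -> (j \in i |: T) = (j \in T).
  by move=> jS; rewrite in_setU1; case: eqVneq jS iS => // -> ->.
have agT' j : j \in S -> (j \in T) = (j \in i |: T) by move/agT.
have [[z Oz]|O0] := pselect (ocell B S T !=set0); last first.
  rewrite !hit_empty // => -[z].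
  - by case/ocell_wall => Oz _; apply: O0; exists z.
  - by case/ocell_half; rewrite ocell_agreeU1 // => Oz _; apply: O0; exists z.
  - by case/ocell_half => Oz _; apply: O0; exists z.
have hitU1 : hit x k B S (i |: T) = hit x k B S T.
  by rewrite /hit ocell_agreeU1 // ccell_agreeU1.
have [[z0 Oz0]|nocut] := pselect (ocell (i |: B) S T !=set0); last first.
  have nocutU : ~ (ocell (i |: B) S (i |: T) !=set0) by rewrite ocell_agreeU1.
  rewrite (hit_empty _ _ nocut) addn0.
  have [zn|zp|z0] := ltgtP (gap i z) 0.
  - have opp : side (i |: T) i = - side T i :> R.
      by rewrite sideU1 side_notin // opprK.
    have Hz : ocell B (i |: S) T z.
      by apply/ocell_half; rewrite side_notin // mulN1r oppr_gt0.
    by have [-> ->] := hit_uncut x k opp agT nocut Hz; rewrite addn0.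
  - have opp : side T i = - side (i |: T) i :> R by rewrite sideU1 side_notin.
    have Hz : ocell B (i |: S) (i |: T) z.
      by apply/ocell_half; rewrite ocell_agreeU1 // sideU1 mul1r.
    by have [-> ->] := hit_uncut x k opp agT' nocutU Hz; rewrite add0n hitU1.
  - by case: nocut; exists z; apply/ocell_wall.
have [Oz1 z0i] := iffLR (ocell_wall _ _ _ _ _) Oz0.
have [zB _] := Oz1.
(* a direction of the flat that is transverse to the wall: following it both
   ways from [z0] reaches the two halves *)
pose v := y - z0.
have vB : v \in dir B by exact: flat_of_sub_dir.
have cv : dotp (c i) v = gap i y by rewrite /v dotpBr -(subr0 (gap i y)) -z0i /gap; ring.
have [e e0 Oe] := ocell_move Oz1 vB.
have Ope : ocell B S T (z0 + e *: v) by apply: Oe; rewrite ger0_norm // ltW.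
have Ome : ocell B S T (z0 + (- e) *: v).
  by apply: Oe; rewrite normrN ger0_norm // ltW.
have gpe : gap i (z0 + e *: v) = e * gap i y by rewrite gap_move z0i cv add0r.
have gme : gap i (z0 + (- e) *: v) = - (e * gap i y).
  by rewrite gap_move z0i cv add0r mulNr.
have [On Op] : ocell B (i |: S) T !=set0 /\ ocell B (i |: S) (i |: T) !=set0.
  have [yn|yp|//] := ltgtP (gap i y) 0.
    have ey : e * gap i y < 0 by rewrite pmulr_rlt0.
    split; [exists (z0 + e *: v)|exists (z0 + (- e) *: v)]; apply/ocell_half.
      by rewrite side_notin // gpe; split=> //; lra.
    by rewrite sideU1 gme ocell_agreeU1 //; split=> //; lra.
  have ey : 0 < e * gap i y by rewrite mulr_gt0.
  split; [exists (z0 + (- e) *: v)|exists (z0 + e *: v)]; apply/ocell_half.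
    by rewrite side_notin // gme; split=> //; lra.
  by rewrite sideU1 gpe ocell_agreeU1 //; split=> //; lra.
rewrite !hit_nonempty //; [|by exists z0|by exists z].
have Q0 : ccell (i |: B) S T !=set0 by exists z0; exact: ocell_sub.
have Q0U : ccell (i |: B) S (i |: T) !=set0 by rewrite ccell_agreeU1.
have [|Cp pmin] := @ccell_projP _ _ _ c b B S T x.
  by exists z; exact: ocell_sub.
set p := metric_proj _ x in Cp pmin.
have CpU : ccell B S (i |: T) p by rewrite ccell_agreeU1.
have pminU z' : ccell B S (i |: T) z' -> sqdist x p <= sqdist x z'.
  by rewrite ccell_agreeU1 //; exact: pmin.
have [pn|pp|pi] := ltgtP (gap i p) 0.
- rewrite (dim_proj_near_side Cp pmin); last by rewrite side_notin // mulN1r oppr_gt0.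
  rewrite (dim_proj_far_side CpU pminU) //; last by rewrite sideU1 mul1r.
  by rewrite ccell_agreeU1.
- rewrite (dim_proj_far_side Cp pmin) //; last by rewrite side_notin // mulN1r oppr_lt0.
  rewrite (dim_proj_near_side CpU pminU); last by rewrite sideU1 mul1r.
  by rewrite ccell_agreeU1 // addnC.
- rewrite (dim_proj_wall_half Cp pmin pi) (dim_proj_wall_half CpU pminU pi).
  by rewrite ccell_agreeU1 // (dim_proj_wall Cp pmin genx pi).
Qed.

End Counting.

(** * The recursion for the characteristic polynomial *)

Lemma sum_subsetU1 (V : nmodType) (I : finType) (i : I) (S : {set I})
    (f : {set I} -> V) : i \notin S ->
  \sum_(T : {set I} | T \subset i |: S) f T =
  \sum_(T : {set I} | T \subset S) (f T + f (i |: T)).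
Proof.
move=> iS; rewrite (bigID (fun T : {set I} => i \notin T)) /= big_split; congr (_ + _).
  by apply: eq_bigl => T; rewrite -subsetD1 finset.setU1K.
rewrite (reindex_onto (fun T => i |: T) (fun T => T :\ i)) /=; last first.
  by move=> T /andP[_]; rewrite negbK; exact: finset.setD1K.
apply: eq_bigl => T; rewrite negbK finset.setU11 andbT.
apply/andP/idP => [[TS /eqP <-]|TS].
  by rewrite -(finset.setU1K iS); exact: finset.setSD.
have iT : i \notin T by apply: contra iS; exact: (fintype.subsetP TS).
by rewrite finset.setUS // finset.setU1K.
Qed.

Section Recursion.
Context {R : realType} {d m : nat}.
Variables (c : 'I_m -> 'rV[R]_d) (b : 'I_m -> R).
Implicit Types (x y z v w p : 'rV[R]_d) (t : R) (A B S T : {set 'I_m}).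
Implicit Types (i j : 'I_m) (k : nat).

Local Notation gap := (gap c b).
Local Notation flat_of := (flat_of c b).
Local Notation ccell := (ccell c b).
Local Notation ocell := (ocell c b).
Local Notation dir := (dir c).
Local Notation hit := (hit c b).

(** The coefficient of degree [k] of the characteristic polynomial of the
    arrangement that the hyperplanes of [S] cut out in the flat of [B]. *)
Definition whitney_coef k B S : int :=
  \sum_(A : {set 'I_m} | A \subset S)
    (-1) ^+ #|A| *
    (`[< flat_of (B :|: A) !=set0 >] && (\dim (dir (B :|: A)) == k))%:R.

Definition count_hits x k B S : int :=
  \sum_(T : {set 'I_m} | T \subset S) (hit x k B S T)%:R.

Lemma whitney_coefU1 k B S i : i \notin S ->
  whitney_coef k B (i |: S) = whitney_coef k B S - whitney_coef k (i |: B) S.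
Proof.
move=> iS; rewrite /whitney_coef sum_subsetU1 // big_split /=; congr (_ + _).
rewrite -sumrN; apply: eq_bigr => A AS.
have iA : i \notin A by apply: contra iS; exact: (fintype.subsetP AS).
by rewrite cardsU1 iA exprS mulN1r mulNr finset.setUCA finset.setUA.
Qed.

Lemma flat_ofU B A y : flat_of (B :|: A) y <-> flat_of B y /\ flat_of A y.
Proof.
split=> [yBA|[yB yA] i]; last by rewrite inE => /orP[/yB|/yA].
by split=> i iB; apply: yBA; rewrite inE iB ?orbT.
Qed.

Lemma dirU B A : dir (B :|: A) = (dir B :&: dir A)%VS.
Proof.
apply/vspaceP => v; rewrite memv_cap; apply/mem_dir/andP => [vBA|[]].
  by split; apply/mem_dir => i iB; apply: vBA; rewrite inE iB ?orbT.
by move=> /mem_dir vB /mem_dir vA i; rewrite inE => /orP[/vB|/vA].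
Qed.

Lemma dir_wall B i z : flat_of B z -> gap i z = 0 ->
  flat_of B `<=` [set y | gap i y = 0] <-> (dir B <= perpv (c i))%VS.
Proof.
move=> zB zi; split=> [wall|/subvP sub y yB].
  apply/subvP => v /mem_dir vB; rewrite mem_perpv.
  have : gap i (z + 1 *: v) = 0.
    by apply: wall => j jB; rewrite gap_move zB // vB // mulr0 addr0.
  by rewrite gap_move zi mul1r add0r => ->.
have := sub _ (flat_of_sub_dir yB zB); rewrite mem_perpv dotpBr => /eqP.
by rewrite /= /gap in zi *; lra.
Qed.

(** Both sides obey the same deletion-restriction recursion in [S].  The sign
    absorbs the difference of the two recursions, as restriction lowers the
    dimension by one.  If the wall [i] contains the flat, deletion and
    restriction cancel on the left, and there is no open cell on the right. *)
Lemma whitney_coef_count x k S B : generic c b x ->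
  whitney_coef k B S =
  if `[< flat_of B !=set0 >] then (-1) ^+ (\dim (dir B) + k) * count_hits x k B S
  else 0.
Proof.
move=> genx; have [n] := ubnP #|S|; elim: n => // n IHn in S B *.
have [->|[i iS]] := set_0Vmem S => [_|]; last rewrite -(finset.setD1K iS).
  rewrite /whitney_coef /count_hits (big_pred1 finset.set0); last first.
    by move=> A /=; rewrite finset.subset0.
  rewrite (big_pred1 finset.set0); last by move=> A /=; rewrite finset.subset0.
  rewrite finset.setU0 cards0 expr0 mul1r.
  have -> : hit x k B finset.set0 finset.set0 =
      `[< flat_of B !=set0 >] && (\dim (dir B) == k).
    have eqO : ocell B finset.set0 finset.set0 = flat_of B.
      by apply/seteqP; split=> y => [[]|yB] //; split=> // i; rewrite inE.
    rewrite /hit eqO; case: asboolP => //= -[z zB].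
    rewrite dim_proj_ccell; last by exists z; split=> // i; rewrite inE.
    rewrite (_ : active _ _ _ _ = finset.set0) ?finset.setU0 //.
    by apply/setP => i; rewrite !inE.
  case: asboolP => //= _; case: eqP => [->|_]; last by rewrite mulr0.
  by rewrite addnn -signr_odd odd_double mul1r.
have iS' : i \notin S :\ i by rewrite finset.setD11.
move: (S :\ i) iS' => {iS}S iS; rewrite cardsU1 iS add1n ltnS => ltSn.
have [wall|nowall] := pselect (flat_of B `<=` [set y | gap i y = 0]).
  have eqF : flat_of (i |: B) = flat_of B.
    apply/seteqP; split=> y; first by move/flat_ofU1 => [].
    by move=> yB; apply/flat_ofU1; split=> //; exact: wall.
  have count0 : count_hits x k B (i |: S) = 0.
    apply: big1 => T _; rewrite hit_empty // => -[y /ocell_half[[yB _]]].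
    by rewrite (wall y yB) mulr0 ltxx.
  rewrite count0 mulr0 if_same whitney_coefU1 //.
  apply/eqP; rewrite subr_eq0; apply/eqP; apply: eq_bigr => A _.
  congr (_ * (nat_of_bool _)%:R).
  have -> : flat_of ((i |: B) :|: A) = flat_of (B :|: A).
    by apply/seteqP; split=> y /flat_ofU yBA; apply/flat_ofU; rewrite eqF in yBA *.
  case: asboolP => //= -[z /flat_ofU[zB _]].
  rewrite (dirU (i |: B)) (dirU B) dirU1; have /capv_idPl -> // : (dir B <= perpv (c i))%VS.
  by apply/(dir_wall zB) => //; exact: wall.
have countU1 : count_hits x k B (i |: S) =
    count_hits x k B S + count_hits x k (i |: B) S.
  rewrite /count_hits sum_subsetU1 // -big_split; apply: eq_bigr => T TS.
  by rewrite -natrD hit_split // natrD.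
rewrite whitney_coefU1 // countU1 !IHn //.
case: (asboolP (flat_of B !=set0)) => [_|B0]; last first.
  case: asboolP => [[z /flat_ofU1[zB _]]|_]; last by rewrite subr0.
  by case: B0; exists z.
case: asboolP => [[z /flat_ofU1[zB zi]]|B0].
  have notsub : ~~ (dir B <= perpv (c i))%VS.
    by apply/negP => /(dir_wall zB zi).
  by rewrite dirU1 -(dim_cap_perpv notsub) addSn exprS mulN1r !mulNr mulrDr opprD.
rewrite subr0 [X in _ + X](_ : _ = 0) ?addr0 //.
by apply: big1 => T _; rewrite hit_empty // => -[y [yB _]]; apply: B0; exists y.
Qed.

End Recursion.

(** * Chambers *)

Section Chambers.
Context {R : realType} {d m : nat}.
Variables (c : 'I_m -> 'rV[R]_d) (b : 'I_m -> R).
Implicit Types (x y z v w p : 'rV[R]_d) (t : R) (A B S T : {set 'I_m}).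
Implicit Types (i j : 'I_m) (k : nat).

Local Notation gap := (gap c b).
Local Notation flat_of := (flat_of c b).
Local Notation ccell := (ccell c b).
Local Notation ocell := (ocell c b).

Lemma mix0 y z : mix 0 y z = y.
Proof. by rewrite /mix subr0 scale1r scale0r addr0. Qed.

Lemma mix1 y z : mix 1 y z = z.
Proof. by rewrite /mix subrr scale1r scale0r add0r. Qed.

Lemma mix_continuous y z : continuous (fun t => mix t y z).
Proof.
move=> t; have -> : (fun t => mix t y z) = fun t => y + t *: (z - y).
  apply/funext => s; rewrite /mix scalerBl scale1r scalerBr -addrA.
  by congr (_ + _); rewrite addrC.
have cz : continuous (fun s : R => s *: (z - y)).
  by move=> s; apply: continuousZr_tmp; exact: cvg_id.
exact: (continuousD (@cst_continuous _ _ y t) (cz t)).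
Qed.

(** An open cell is a union of segments issued from one of its points. *)
Lemma ocell_connected B S T : connected (ocell B S T).
Proof.
have [[z Oz]|O0] := pselect (ocell B S T !=set0); last first.
  rewrite (_ : ocell B S T = classical_sets.set0); first exact: connected0.
  by apply/seteqP; split=> // y Oy; case: O0; exists y.
have -> : ocell B S T =
    \bigcup_(y in ocell B S T) ((fun t => mix t z y) @` `[0, 1]).
  apply/seteqP; split=> y.
    move=> Oy; exists y => //; exists 1; last exact: mix1.
    by rewrite /= in_itv /= ler01 lexx.
  move=> [w Ow [t]]; rewrite /= in_itv /= => /andP[t0 t1] <-.
  have [->|tn0] := eqVneq t 0; first by rewrite mix0.
  by apply: ocell_mix => //; [rewrite lt_neqAle eq_sym tn0 t0|exact: ocell_sub].
apply: bigcup_connected => [|y Oy].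
  by exists z => y Oy; exists 0; rewrite ?mix0 //= in_itv /= lexx ler01.
apply: connected_continuous_connected; first exact: segment_connected.
by apply: continuous_subspaceT; exact: mix_continuous.
Qed.

(** Every point of the closed cell is the end of a segment whose other points lie
    in the open cell. *)
Lemma closure_ocell B S T : ocell B S T !=set0 ->
  closure (ocell B S T) = ccell B S T.
Proof.
move=> [z Oz]; apply/seteqP; split.
  rewrite [X in _ `<=` X](iffLR (closure_id _) (@ccell_closed _ _ _ c b B S T)).
  by apply: closureS; exact: ocell_sub.
move=> y Cy N; rewrite -{1}(mix0 y z) => /(@mix_continuous y z 0).
move=> /nbhs_ballP[e /= e0 eN].
pose t := Num.min (e / 2) 1.
have t0 : 0 < t by rewrite lt_min ltr01 divr_gt0.
exists (mix t y z); split.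
  by apply: ocell_mix => //; rewrite t0 /= ge_min lexx orbT.
apply: eN; rewrite /ball /= sub0r normrN gtr0_norm //.
by rewrite gt_min ltr_pdivrMr // ltr_pMr // ltr1n.
Qed.

(** The image of a connected set is an interval, which avoids [0]. *)
Lemma gap_sign_connected i (C : set 'rV[R]_d) y z : connected C ->
  (forall w, C w -> gap i w != 0) -> C y -> C z -> 0 < gap i y -> 0 < gap i z.
Proof.
move=> connC gapC Cy Cz yi; rewrite ltNge; apply/negP => zi.
have : connected (gap i @` C).
  apply: connected_continuous_connected => //.
  by apply: continuous_subspaceT; exact: gap_continuous.
move=> /connected_intervalP/(_ (gap i z) (gap i y)) => /(_ _ _ 0)[].
- by exists z.
- by exists y.
- by rewrite zi ltW.
by move=> w Cw /eqP; rewrite (negPf (gapC w Cw)).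
Qed.

Definition sign_of x : {set 'I_m} := [set i | 0 < gap i x].

Lemma ocell_sign_of x : (forall i, gap i x != 0) ->
  ocell finset.set0 [set: 'I_m] (sign_of x) x.
Proof.
move=> gapx; split=> i; rewrite !inE // => _; rewrite /side inE.
have [xi|xi|xi] := ltgtP (gap i x) 0; rewrite ?mulN1r ?mul1r ?oppr_gt0 //.
by have := gapx i; rewrite xi eqxx.
Qed.

Lemma ocell_sign T x : ocell finset.set0 [set: 'I_m] T x ->
  sign_of x = T /\ forall i, gap i x != 0.
Proof.
move=> [_ xS].
have xi i : 0 < side T i * gap i x by apply: xS; rewrite inE.
split=> [|i].
  apply/setP => i; rewrite inE; have := xi i; rewrite /side.
  case: (i \in T); first by rewrite mul1r.
  by rewrite mulN1r oppr_gt0 ltNge => xi0; apply/negbTE; rewrite -leNgt ltW // ltNge.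
by apply/eqP => xi0; have := xi i; rewrite xi0 mulr0 ltxx.
Qed.

Lemma component_ocell T x : ocell finset.set0 [set: 'I_m] T x ->
  connected_component [set y | forall i, gap i y != 0] x =
  ocell finset.set0 [set: 'I_m] T.
Proof.
move=> Ox; have [eqT gapx] := ocell_sign Ox.
apply/seteqP; split; last first.
  apply: connected_component_max => //; last exact: ocell_connected.
  by move=> y /ocell_sign[].
move=> y [C [Cx CA connC] Cy]; rewrite -eqT.
have gapC i w : C w -> gap i w != 0 by move=> /CA /(_ i).
rewrite (_ : sign_of x = sign_of y); first by apply: ocell_sign_of => i; exact: gapC.
apply/setP => i; rewrite !inE.
by apply/idP/idP; apply: (gap_sign_connected connC (gapC i)).
Qed.

Lemma ccell_inj T T' : ocell finset.set0 [set: 'I_m] T !=set0 ->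
  ccell finset.set0 [set: 'I_m] T = ccell finset.set0 [set: 'I_m] T' -> T = T'.
Proof.
move=> [x Ox] eqC; have [eqT gapx] := ocell_sign Ox.
have [_ xS] : ccell finset.set0 [set: 'I_m] T' x by rewrite -eqC; exact: ocell_sub.
suff /ocell_sign[<-] : ocell finset.set0 [set: 'I_m] T' x by [].
split=> i; first by rewrite inE.
by move=> iS; rewrite lt_neqAle xS // eq_sym mulf_neq0 // side_neq0.
Qed.

Lemma adim_flat_of B : flat_of B !=set0 -> adim (flat_of B) = \dim (dir c B).
Proof.
move=> [p pB]; apply: (adim_eq pB) => [y yB|v /mem_dir vB].
  exact: flat_of_sub_dir yB pB.
exists 1; first exact: oner_neq0.
by move=> i iB; rewrite gap_move pB // vB // mulr0 addr0.
Qed.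

End Chambers.

Section Arrangement.
Context {R : realType} {d m : nat}.
Variables (c : 'I_m -> 'rV[R]_d) (b : 'I_m -> R) (H : 'I_m -> set 'rV[R]_d).
Hypothesis HE : forall i, H i = hyperplane (c i) (b i).
Implicit Types (x y : 'rV[R]_d) (B T : {set 'I_m}) (i : 'I_m) (k : nat).

Lemma hyperplaneE i x : H i x <-> gap c b i x = 0.
Proof.
rewrite HE /gap; split=> [->|/eqP]; first by rewrite subrr.
by rewrite subr_eq0 => /eqP.
Qed.

Lemma arr_interE B : arr_inter H B = flat_of c b B.
Proof. by apply/seteqP; split=> x xB i iB; apply/hyperplaneE/xB. Qed.

Lemma complementE : ~` (\bigcup_i H i) = [set y | forall i, gap c b i y != 0].
Proof.
apply/seteqP; split=> x.
  by move=> nx i; apply/eqP => /hyperplaneE xi; apply: nx; exists i.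
by move=> gapx [i _ /hyperplaneE/eqP]; rewrite (negPf (gapx i)).
Qed.

Lemma chambersE : chambers H =
  [set ccell c b finset.set0 [set: 'I_m] T | T in
    [set T | ocell c b finset.set0 [set: 'I_m] T !=set0]].
Proof.
rewrite /chambers complementE; apply/seteqP; split=> P /=.
  move=> [x gapx <-]; have Ox := ocell_sign_of gapx.
  exists (sign_of c b x); first by exists x.
  by rewrite (component_ocell Ox) closure_ocell //; exists x.
move=> [T [x Ox] <-]; have [_ gapx] := ocell_sign Ox; exists x => //.
by rewrite (component_ocell Ox) closure_ocell //; exists x.
Qed.

Lemma coef_arr_char_poly k :
  (arr_char_poly H)`_k = whitney_coef c b k finset.set0 [set: 'I_m].
Proof.
rewrite /arr_char_poly /whitney_coef coef_sum big_mkcond /=.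
apply: eq_big => [B|B _]; first by rewrite finset.subsetT.
rewrite finset.set0U arr_interE coefZ coefXn; case: asboolP => [B0|_] /=.
  by rewrite adim_flat_of // eq_sym.
by rewrite mulr0.
Qed.

Definition hitting x k : {set {set 'I_m}} :=
  [set T | hit c b x k finset.set0 [set: 'I_m] T].

Lemma chambers_hitting x k : [set P | chambers H P /\ dim_proj x P = k] =
  [set` [fset ccell c b finset.set0 [set: 'I_m] T | T in hitting x k]%fset].
Proof.
apply/seteqP; split=> P /=.
  rewrite chambersE => -[[T OT <-] dimk]; apply/imfsetP; exists T => //=.
  by rewrite inE hit_nonempty // dimk.
move=> /imfsetP[T /=]; rewrite inE => /andP[/asboolP OT /eqP dimk] ->.
by split=> //; rewrite chambersE; exists T.
Qed.

Lemma card_chambers x k :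
  #|` fset_set [set P | chambers H P /\ dim_proj x P = k]|%:Z =
  count_hits c b x k finset.set0 [set: 'I_m].
Proof.
rewrite chambers_hitting set_fsetK card_in_imfset /=; last first.
  move=> T T'; rewrite !inE => /andP[/asboolP OT _] _.
  exact: ccell_inj.
rewrite -cardE /count_hits -sum1_card -natz natr_sum big_mkcond /=.
rewrite [RHS]big_mkcond; apply: eq_bigr => T _.
by rewrite finset.subsetT inE; case: ifP.
Qed.

End Arrangement.


Theorem theorem1p1 (R : realType) (d m : nat) (H : 'I_m -> set 'rV[R]_d)
    (a : 'I_d.+1 -> int) (k : 'I_d.+1) :
  is_arrangement H ->
  arr_char_poly H = \sum_(j < d.+1) ((-1) ^+ (d - j) * a j) *: 'X^j ->
  exists E : set 'rV[R]_d, finite_union_of_hyperplanes E /\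
    forall x : 'rV[R]_d, ~ E x ->
      finite_set [set P | chambers H P /\ dim_proj x P = k] /\
      #|` fset_set [set P | chambers H P /\ dim_proj x P = k] |%:Z = a k.
Proof.
move=> [hypH _] chiH.
have [c /choice[b Hcb]] := choice hypH.
have c0 i : c i != 0 by case: (Hcb i).
have HE i : H i = hyperplane (c i) (b i) by case: (Hcb i).
have [E [unionE genE]] := generic_outside_hyperplanes b c0.
exists E; split=> // x /genE genx; split.
  by rewrite (chambers_hitting HE); exact: finite_fset.
rewrite (card_chambers HE).
have := congr1 (fun p : {poly int} => p`_k) chiH.
rewrite (coef_arr_char_poly HE) (whitney_coef_count _ _ _ genx) coef_sum.
rewrite (bigD1 k) //= coefZ coefXn eqxx mulr1 big1 ?addr0 => [|j jk]; last first.
  by rewrite coefZ coefXn eq_sym val_eqE (negPf jk) mulr0.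
have -> : `[< flat_of c b finset.set0 !=set0 >].
  by apply/asboolP; exists 0 => i; rewrite inE.
have -> : \dim (dir c finset.set0) = d.
  by rewrite /dir big_set0 dimvf /dim /= mul1n.
rewrite -(signr_odd _ (d + k)) -(signr_odd _ (d - k)).
rewrite oddD oddB; last by rewrite -ltnS.
by move/(canRL (signrMK _)) ->; rewrite signrMK.
Qed.
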